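(* Let $U \subset \mathbb{R}^2$ be an open, connected (not necessarily simply connected) domain, and let $\omega = M(x,y)\,dx + N(x,y)\,dy$ be a smooth, closed 1-form on $U$, i.e. $\frac{\partial N}{\partial x} = \frac{\partial M}{\partial y}$ on $U$. Suppose that the de Rham cohomology class $[\omega] \in H^1_{\mathrm{dR}}(U)$ is trivial (i.e. $\omega$ is exact). Then there exists a smooth function $F : U \to \mathbb{R}$ such that $dF = \omega$, and the general solution to the differential equation $M(x,y)\,dx + N(x,y)\,dy = 0$ on $U$ is given by $F(x,y) = C$ for arbitrary constants $C \in \mathbb{R}$; that is, a $C^1$ curve $\gamma = (x(t),y(t)) : I \to U$ on an interval $I \subset \mathbb{R}$ satisfies $M(x(t),y(t))\,x'(t) + N(x(t),y(t))\,y'(t) = 0$ for all $t \in I$ if and only if there is a constant $C \in \mathbb{R}$ with $F(x(t),y(t)) = C$ for all $t \in I$. Moreover, such a function $F$ is unique up to an additive constant: if $\tilde F : U \to \mathbb{R}$ is another smooth function with $d\tilde F = \omega$, then $F - \tilde F$ is constant on $U$.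
   Context: $H^1_{\mathrm{dR}}(U)$ denotes the first de Rham cohomology group of $U$, the quotient of the space of closed 1-forms on $U$ by the space of exact 1-forms on $U$. A 1-form $\omega$ on $U$ is exact if there exists a smooth function $F : U \to \mathbb{R}$ with $\omega = dF$, i.e. $\frac{\partial F}{\partial x} = M$ and $\frac{\partial F}{\partial y} = N$; it is closed if $d\omega = 0$. The differential equation $M\,dx + N\,dy = 0$ is identified with the 1-form $\omega$, and its solution curves are the curves in $U$ whose tangent vectors lie in the kernel of $\omega$. *)

(* Defs.v *)
From HB Require Import structures.
From mathcomp Require Import all_boot all_order all_algebra.
From mathcomp Require Import generic_quotient ring_quotient.
From mathcomp Require Import all_classical all_reals all_analysis.

Set Implicit Arguments.
Unset Strict Implicit.
Unset Printing Implicit Defensive.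

Import Order.TTheory GRing.Theory Num.Theory numFieldNormedType.Exports.

Local Open Scope classical_set_scope.
Local Open Scope ring_scope.
Local Open Scope quotient_scope.

(* Functions on an open set U of the plane are represented by total functions
   R * R -> R of which only the values on U are constrained. *)

Lemma near_eq_differentiable (K : numFieldType) (V W : normedModType K)
    (f g : V -> W) (p : V) :
  (\near p, f p = g p) -> differentiable f p -> differentiable g p.
Proof.
move=> fg /diff_locallyP[df fE].
have gE : g \o shift p = cst (g p) + 'd f p +o_ 0 id.
  apply/eqaddoP => _/posnumP[e].
  have /eqaddoP/(_ e%:num (gt0 e)) := fE.
  have := fg; rewrite (near_shift 0) subr0 => fg0.
  apply: filter_app; apply: filterS fg0 => q /= Eq.
  by rewrite /= !fctE /= -(nbhs_singleton fg) -Eq.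
have gfE := diff_unique df gE.
by apply/diff_locallyP; rewrite gfE.
Qed.

Section Smooth.
Variable R : realType.
Implicit Types (U : set (R * R)) (f g : R * R -> R).

Definition partialx f (p : R * R) : R := 'D_(1, 0) f p.
Definition partialy f (p : R * R) : R := 'D_(0, 1) f p.

Fixpoint Ck_on U (n : nat) f : Prop :=
  if n is m.+1 then
    [/\ forall p, U p -> differentiable f p,
        Ck_on U m (partialx f) & Ck_on U m (partialy f)]
  else forall p, U p -> {for p, continuous f}.

Definition smooth_on U f : Prop := forall n, Ck_on U n f.


Lemma near_open_eq U f g : open U -> (forall p, U p -> f p = g p) ->
  forall p, U p -> \near p, f p = g p.
Proof.
move=> oU fg p Up; near=> q; apply: fg; near: q.
exact: open_nbhs_nbhs.
Unshelve. all: by end_near. Qed.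

Lemma Ck_on_eq U n f g : open U -> (forall p, U p -> f p = g p) ->
  Ck_on U n f -> Ck_on U n g.
Proof.
move=> oU; elim: n f g => [|n IH] f g fg /=.
  move=> Cf p Up; rewrite /prop_for /continuous_at.
  have <- : f p = g p := fg p Up.
  apply: cvg_trans (Cf p Up); apply: near_eq_cvg.
  exact: near_open_eq fg p Up.
move=> [df dfx dfy]; split.
- move=> p Up; apply: near_eq_differentiable (df p Up).
  exact: near_open_eq fg p Up.
- by apply: IH dfx => p Up; apply: near_eq_derive; exact: near_open_eq fg p Up.
- by apply: IH dfy => p Up; apply: near_eq_derive; exact: near_open_eq fg p Up.
Qed.

Lemma partialxB f g p : differentiable f p -> differentiable g p ->
  partialx (f - g) p = partialx f p - partialx g p.
Proof. by move=> df dg; apply: deriveB; exact: diff_derivable. Qed.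

Lemma partialyB f g p : differentiable f p -> differentiable g p ->
  partialy (f - g) p = partialy f p - partialy g p.
Proof. by move=> df dg; apply: deriveB; exact: diff_derivable. Qed.

Lemma partialx0 p : partialx 0 p = 0.
Proof. exact: derive_cst. Qed.

Lemma partialy0 p : partialy 0 p = 0.
Proof. exact: derive_cst. Qed.

Lemma Ck_onB U n f g : open U -> Ck_on U n f -> Ck_on U n g ->
  Ck_on U n (f - g).
Proof.
move=> oU; elim: n f g => [|n IH] f g /=.
  by move=> Cf Cg p Up; apply: cvgB; [exact: Cf|exact: Cg].
move=> [df dfx dfy] [dg dgx dgy]; split.
- by move=> p Up; apply: differentiableB; [exact: df|exact: dg].
- apply: Ck_on_eq (IH _ _ dfx dgx) => // p Up.
  by rewrite partialxB; [|exact: df|exact: dg].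
- apply: Ck_on_eq (IH _ _ dfy dgy) => // p Up.
  by rewrite partialyB; [|exact: df|exact: dg].
Qed.

Lemma Ck_on0 U n : Ck_on U n 0.
Proof.
elim: n => [|n IH] /=; first by move=> p Up; exact: cvg_cst.
have x0 : partialx 0 = 0 by apply/funext => p; exact: partialx0.
have y0 : partialy 0 = 0 by apply/funext => p; exact: partialy0.
by rewrite x0 y0; split.
Qed.

Lemma smooth_onB U f g : open U -> smooth_on U f -> smooth_on U g ->
  smooth_on U (f - g).
Proof. by move=> oU sf sg n; exact: Ck_onB. Qed.

Lemma smooth_on_differentiable U f p :
  smooth_on U f -> U p -> differentiable f p.
Proof. by move=> /(_ 1%N) [+ _ _]; exact. Qed.

End Smooth.

Section DeRham.
Variables (R : realType) (U : set (R * R)) (oU : open U).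

(* (M, N) stands for the 1-form M dx + N dy. *)
Definition form1 : Type := ((R * R -> R) * (R * R -> R))%type.
HB.instance Definition _ := GRing.Zmodule.on form1.

Definition closed_on (w : form1) : Prop :=
  [/\ smooth_on U w.1, smooth_on U w.2 &
      forall p, U p -> partialx w.2 p = partialy w.1 p].

Definition primitive_on (w : form1) (F : R * R -> R) : Prop :=
  smooth_on U F /\
  forall p, U p -> partialx F p = w.1 p /\ partialy F p = w.2 p.

Definition exact_on (w : form1) : Prop := exists F, primitive_on w F.

(* The argument oU, absent from the bodies, is what makes the instances below
   available: over a set that is not open, smooth functions as defined above
   need not be stable under subtraction. *)
Definition closed_pred of open U : {pred form1} := fun w => `[< closed_on w >].

Lemma closed_zmod_closed : zmod_closed (closed_pred oU).
Proof.
split.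
  apply/asboolP; split => [n|n|p Up]; [exact: Ck_on0|exact: Ck_on0|].
  by rewrite partialx0 partialy0.
move=> v w /asboolP[sv1 sv2 cv] /asboolP[sw1 sw2 cw]; apply/asboolP.
split; [exact: smooth_onB|exact: smooth_onB|] => p Up /=.
rewrite partialxB ?partialyB ?cv ?cw//;
  by [exact: (smooth_on_differentiable sv1)|exact: (smooth_on_differentiable sv2)
     |exact: (smooth_on_differentiable sw1)|exact: (smooth_on_differentiable sw2)].
Qed.

HB.instance Definition _ :=
  GRing.isZmodClosed.Build form1 (closed_pred oU) closed_zmod_closed.

Record closed_form := MkClosedForm {
  closed_form_val :> form1; _ : closed_form_val \in closed_pred oU }.

HB.instance Definition _ := [isSub for closed_form_val].
HB.instance Definition _ := [Choice of closed_form by <:].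
HB.instance Definition _ := [SubChoice_isSubZmodule of closed_form by <:].

Definition exact_pred : {pred closed_form} :=
  fun w => `[< exact_on (val w) >].

Lemma exact_zmod_closed : zmod_closed exact_pred.
Proof.
split.
  apply/asboolP; exists 0; split => [n|p Up]; first exact: Ck_on0.
  by rewrite partialx0 partialy0.
move=> v w /asboolP[F [sF dF]] /asboolP[G [sG dG]]; apply/asboolP.
exists (F - G); split => [|p Up]; first exact: smooth_onB.
have dfF := smooth_on_differentiable sF Up.
have dfG := smooth_on_differentiable sG Up.
have [Fx Fy] := dF p Up; have [Gx Gy] := dG p Up.
by rewrite partialxB// partialyB// Fx Fy Gx Gy.
Qed.

HB.instance Definition _ :=
  GRing.isZmodClosed.Build closed_form exact_pred exact_zmod_closed.

(* Two forms that agree on U differ by an exact form, so representing forms by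
   total functions does not change the quotient. *)
Definition H1dR : zmodType := Quotient.quot exact_pred.

Lemma closed_form_subproof M N : smooth_on U M -> smooth_on U N ->
  (forall p, U p -> partialx N p = partialy M p) -> (M, N) \in closed_pred oU.
Proof. by move=> sM sN c; apply/asboolP. Qed.

Definition ClosedForm M N (sM : smooth_on U M) (sN : smooth_on U N)
    (c : forall p, U p -> partialx N p = partialy M p) : closed_form :=
  MkClosedForm (closed_form_subproof sM sN c).

Definition dR_class (w : closed_form) : H1dR := \pi_(Quotient.quot exact_pred) w.

Lemma dR_class_eq0 w : dR_class w = 0 <-> exact_on (val w).
Proof.
rewrite /dR_class -(raddf0 (\pi_(Quotient.quot exact_pred))).
split => [/eqP|ew].
  by rewrite -Quotient.idealrBE subr0 => /asboolP.
by apply/eqP; rewrite -Quotient.idealrBE subr0; exact/asboolP.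
Qed.

End DeRham.

Section Curves.
Variable R : realType.
Implicit Types (I : set R) (x : R -> R).

(* Derivatives relative to I: one-sided at an end point of an interval I that
   belongs to I, the usual derivative at an interior point. They carry no
   information at an isolated point of I, where the filter is improper. *)
Definition diff_quotient x (t s : R) : R := (x s - x t) / (s - t).
Definition derivable_within I x (t : R) : Prop :=
  cvg (diff_quotient x t s @[s --> within I t^']).
Definition derive_within I x (t : R) : R :=
  lim (diff_quotient x t s @[s --> within I t^']).

Definition C1_within I x : Prop :=
  (forall t, I t -> derivable_within I x t) /\
  {within I, continuous (derive_within I x)}.

End Curves.

(* Main.v *)
Require Import Defs.
From HB Require Import structures.
From mathcomp Require Import all_boot all_order all_algebra.
From mathcomp Require Import all_classical all_reals all_analysis.

Set Implicit Arguments.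
Unset Strict Implicit.
Unset Printing Implicit Defensive.

Import Order.TTheory GRing.Theory Num.Theory numFieldNormedType.Exports.

Local Open Scope classical_set_scope.
Local Open Scope ring_scope.

(* Along a C^1 curve the chain rule gives (F o gamma)' = M x' + N y', one-sidedly
   at end points of I belonging to I, so the equation holds iff F o gamma has
   zero derivative on the interval I, iff it is constant by the mean value
   theorem. The same argument on line segments shows that a function with zero
   partial derivatives is locally constant, hence constant on the connected
   set U; applied to the difference of two primitives, this gives uniqueness. *)

Lemma diff_partials (R : realType) (F : R * R -> R) (p : R * R) (a b : R) :
  differentiable F p -> 'd F p (a, b) = partialx F p * a + partialy F p * b.
Proof.
move=> dF; rewrite /partialx /partialy !deriveE//.
have -> : (a, b) = a *: (1, 0) + b *: (0, 1) :> R * R.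
  by congr pair; rewrite /= /GRing.scale /= !(mulr1, mulr0, addr0, add0r).
by rewrite linearD !linearZ /= mulrC [b *: _]mulrC.
Qed.

Lemma near_within_dnbhs (T : topologicalType) (A : set T) (t : T) :
  \forall s \near within A t^', A s /\ s != t.
Proof.
by apply: filterS (nbhs_dnbhs_neq t) => s st As.
Qed.

(** Differentiability implies continuity: away from [t], [x s - x t] is the difference quotient
    times [s - t], which tends to [a * 0]. *)
Lemma cvg_diff_quotient_within_cvg (R : realType) (I : set R) (x : R -> R)
    (t a : R) :
  diff_quotient x t s @[s --> within I t^'] --> a ->
  x s @[s --> within I t^'] --> x t.
Proof.
move=> xa; apply/subr_cvg0.
rewrite -(mulr0 a); set G := within I t^'.
have st : (s - t) @[s --> G] --> (0 : R).
  apply/subr_cvg0; apply: cvg_within_filter; exact: nbhs_dnbhs.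
apply: cvg_trans (cvgM xa st); apply: near_eq_cvg.
apply: filterS (near_within_dnbhs I t) => s [_ s_neq_t].
by rewrite /= /diff_quotient divfK// subr_eq0.
Qed.

(* Writing F (p + h) = F p + dF h + r h with r = o(h), the difference quotient of
   F along the curve is dF (h / (s - t)) + r h / (s - t), where h / (s - t)
   converges, hence is bounded. *)
Lemma cvg_diff_quotient_comp (R : realType) (F : R * R -> R) (I : set R)
    (x y : R -> R) (t a b : R) :
  differentiable F (x t, y t) ->
  diff_quotient x t s @[s --> within I t^'] --> a ->
  diff_quotient y t s @[s --> within I t^'] --> b ->
  diff_quotient (fun s => F (x s, y s)) t s @[s --> within I t^'] -->
  partialx F (x t, y t) * a + partialy F (x t, y t) * b.
Proof.
move=> dF xa yb; set p := (x t, y t); rewrite -diff_partials//.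
set G := within I t^'.
pose h s : R * R := (x s - x t, y s - y t).
pose k s : R * R := (diff_quotient x t s, diff_quotient y t s).
have kE s : k s = (s - t)^-1 *: h s.
  by rewrite /k /h /diff_quotient; congr pair; rewrite /= mulrC.
have kab : k s @[s --> G] --> (a, b) by exact: (cvg_pair xa yb).
have h0 : h s @[s --> G] --> (0 : R * R).
  apply: (@cvg_pair _ _ _ G (nbhs (0 : R)) (nbhs (0 : R))) => /=.
    by apply/subr_cvg0; exact: cvg_diff_quotient_within_cvg xa.
  by apply/subr_cvg0; exact: cvg_diff_quotient_within_cvg yb.
have /diff_locallyP[cdF /eqaddoP FE] := dF.
set r := (_ - _ : R * R -> R) in FE.
have rE s : diff_quotient (fun s => F (x s, y s)) t s =
    'd F p (k s) + (s - t)^-1 * r (h s).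
  rewrite kE linearZ /= -mulrDr /r !fctE /= /diff_quotient.
  have -> : h s + p = (x s, y s) by rewrite /h /p; congr pair; rewrite /= subrK.
  rewrite [RHS]mulrC; congr (_ * _).
  by rewrite [RHS]addrC opprD addrA subrK.
rewrite (funext rE).
rewrite -[X in _ --> X]addr0; apply: cvgD.
  by apply: cvg_comp kab _; exact: cdF.
apply/cvgr0Pnorm_le => e e0.
(* The added 1 keeps the bound positive when [a = b = 0] and strictly above the norm of the limit of
   [k], so [k] eventually satisfies it. *)
have K0 : 0 < `|(a, b)| + 1 by rewrite ltr_wpDl.
have eK : 0 < e / (`|(a, b)| + 1) by rewrite divr_gt0.
have := h0 _ (FE _ eK); rewrite /= => rh.
have kK : \forall s \near G, `|k s| <= `|(a, b)| + 1.
  by apply: (cvgr_norm_le _ kab); rewrite ltrDl.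
near=> s.
rewrite normrM normfV.
have rs : `|r (h s)| <= e / (`|(a, b)| + 1) * `|h s| by near: s.
have ks : `|k s| <= `|(a, b)| + 1 by near: s.
apply: le_trans (ler_wpM2l _ rs) _; first by rewrite invr_ge0.
rewrite mulrCA -normfV -normrZ -kE mulrAC ler_pdivrMr//.
by rewrite ler_wpM2l// ltW.
Unshelve. all: by end_near. Qed.

(** This makes limits along [within I t^'] unique. The interior point rules out an interval reduced
    to [t], for which the filter is improper. *)
Lemma within_dnbhs_proper (R : realType) (I : set R) (t : R) :
  is_interval I -> I° !=set0 -> I t -> ProperFilter (within I t^').
Proof.
move=> iI [u Iu] It.
have [s Is st] : exists2 s, I s & s != t.
  (* If the interior point is [t] itself, [I] is a neighbourhood of [t] and so contains some other
     point. *)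
  have [ut|ut] := eqVneq u t; last by exists u => //; exact: interior_subset Iu.
  have [v [Iv vu]] : exists v, I v /\ v != u.
    apply: (@filter_ex _ u^'); near=> v.
    split; last by near: v; exact: nbhs_dnbhs_neq.
    by near: v; exact: (nbhs_dnbhs Iu).
  by exists v; rewrite // -ut.
(* I contains the segment from t to s, so t is a limit point of I. *)
have phiG : (t + l * (s - t)) @[l --> (0 : R)^'+] --> within I t^'.
  have lt : (t + l * (s - t)) @[l --> (0 : R)^'+] --> t.
    rewrite -[X in _ --> X]addr0; apply: cvgD; first exact: cvg_cst.
    rewrite -[X in _ --> X](mul0r (s - t)); apply: cvgMl.
    exact: cvg_at_right_filter cvg_id.
  move=> P PI; have lP := lt _ PI.
  suff : \forall l \near (0 : R)^'+, P (t + l * (s - t)) by [].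
  near=> l.
  have l0 : 0 < l by near: l; exact: nbhs_right_gt.
  have l1 : l <= 1 by near: l; exact: nbhs_right_le.
  have Pl : t + l * (s - t) != t -> I (t + l * (s - t)) -> P (t + l * (s - t)).
    by near: l.
  apply: Pl.
    by rewrite -subr_eq0 addrAC subrr add0r mulf_neq0 ?subr_eq0// lt0r_neq0.
  have [ts|ts] := leP t s.
    apply: iI It Is _ _; rewrite lerDl mulr_ge0 ?subr_ge0 ?(ltW l0)//=.
    by rewrite -lerBrDl ler_piMl// subr_ge0.
  apply: iI Is It _ _; rewrite gerDl -opprB mulrN oppr_le0.
  rewrite mulr_ge0 ?subr_ge0 ?(ltW l0) ?(ltW ts)// andbT.
  by rewrite lerBrDl -lerBrDr ler_piMl// subr_ge0 ltW.
by apply: Build_ProperFilter => /phiG /filter_ex[].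
Unshelve. all: by end_near. Qed.

(** The substitution [s = h + t] passes to the library derivative, the form that the mean value
    theorem takes. *)
Lemma derive_of_diff_quotient (R : realType) (g : R -> R) (t l : R) :
  diff_quotient g t s @[s --> t^'] --> l -> is_derive t 1 g l.
Proof.
move=> gl.
have shift_t : (h + t) @[h --> (0 : R)^'] --> t^'.
  move=> P Pt.
  have : \forall s \near t, s != t -> P s by [].
  rewrite (near_shift 0) subr0.
  by apply: filterS => h Ph h0; apply: Ph; rewrite -subr_eq0 addrK.
have gh : h^-1 *: ((g \o shift t) (h *: 1) - g t) @[h --> (0 : R)^'] --> l.
  apply: cvg_trans (cvg_comp _ _ shift_t gl); apply: near_eq_cvg.
  near=> h; rewrite /= /diff_quotient addrK mulrC.
  by rewrite /GRing.scale /= mulr1.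
by apply: DeriveDef; [apply/cvg_ex; exists l|exact/cvg_lim].
Unshelve. all: by end_near. Qed.

(** The mean value theorem on [[s, t]], a part of [I] since [I] is an interval, gives
    [g t - g s = 0 * (t - s)]. *)
Lemma diff_quotient0_cst (R : realType) (I : set R) (g : R -> R) :
  is_interval I ->
  (forall t, I t -> diff_quotient g t s @[s --> within I t^'] --> (0 : R)) ->
  forall s t, I s -> I t -> g s = g t.
Proof.
move=> iI g0 s t Is It; wlog st : s t Is It / s < t.
  by move=> H; have [/H|/H/esym|->] := ltgtP s t; [exact|exact|].
have stI z : z \in `[s, t] -> I z.
  by rewrite in_itv /= => ?; exact: iI Is It _ _.
have dg z : z \in `]s, t[ -> is_derive z 1 g 0.
  move=> zst; apply: derive_of_diff_quotient.
  (* As [I] is a neighbourhood of [z], the limit relative to [I] is the ordinary two-sided one. *)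
  have zI : \forall u \near z, I u.
    near=> u; apply/stI/subset_itv_oo_cc.
    by near: u; exact: near_in_itvoo.
  apply: cvg_trans (g0 z _); last exact/stI/subset_itv_oo_cc.
  apply: cvg_app => P PI; have {}PI : \forall u \near z^', I u -> P u by [].
  by apply: filterS2 (nbhs_dnbhs zI) PI => u Iu; exact.
have cg : {within `[s, t], continuous g}.
  apply/subspace_continuousP => z /= zst.
  (* The limit relative to [I] restricts to [[s, t]], end points included; it is punctured, so
     [u = z] is treated apart. *)
  have gz := cvg_diff_quotient_within_cvg (g0 z (stI z zst)).
  move=> P Pz.
  have Pn : \forall u \near z, u != z -> I u -> P (g u) := gz _ Pz.
  apply: filterS Pn => u Pu ust.
  have [->|uz] := eqVneq u z; first exact: (nbhs_singleton Pz).
  by apply: Pu => //; exact: stI.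
have [c _] := MVT st dg cg.
by rewrite mul0r => /eqP; rewrite subr_eq0 => /eqP.
Unshelve. all: by end_near. Qed.

Lemma zero_partials_locally_cst (R : realType) (G : R * R -> R) (p : R * R)
    (e : R) :
  (forall q, ball p e q -> differentiable G q) ->
  (forall q, ball p e q -> partialx G q = 0 /\ partialy G q = 0) ->
  forall q, ball p e q -> G q = G p.
Proof.
move=> dG G0 q pq.
pose x s := p.1 + s * (q.1 - p.1); pose y s := p.2 + s * (q.2 - p.2).
(* Convexity of the ball: the point at parameter [s] differs from [p] by [s] times the difference of
   [p] and [q]. *)
have seg s : `[0, 1]%classic s -> ball p e (x s, y s).
  rewrite /= in_itv /= => /andP[s0 s1]; move: pq; rewrite ball_prod_normE /=.
  rewrite /ball_ /= /x /y => pq.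
  have -> : p - (p.1 + s * (q.1 - p.1), p.2 + s * (q.2 - p.2)) = s *: (p - q).
    by congr pair; rewrite /= opprD addNKr -mulrN opprB.
  by rewrite normrZ ger0_norm//; apply: le_lt_trans pq; rewrite ler_piMl.
have daff (a b t : R) :
    diff_quotient (fun s => a + s * b) t s @[s --> within `[0, 1] t^'] --> b.
  apply: cvg_near_cst; apply: filterS (near_within_dnbhs _ t) => s [_ st].
  rewrite /diff_quotient opprD addrACA subrr add0r -mulrBl mulrAC mulfV ?mul1r//.
  by rewrite subr_eq0.
(* The parameters 1 and 0 give the end points [q] and [p] of the segment. *)
have := @diff_quotient0_cst R `[0, 1] (fun s => G (x s, y s)) _ _ 1 0.
rewrite /x /y !mul1r !mul0r !addr0 ![_ + (_ - _)]addrC !subrK -!surjective_pairing.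
apply; [exact: interval_is_interval| |by rewrite /= in_itv /= lexx ler01..].
move=> t t01; have xy := seg t t01.
have [Gx Gy] := G0 _ xy.
have := cvg_diff_quotient_comp (dG _ xy) (daff _ _ t) (daff _ _ t).
by rewrite Gx Gy !mul0r addr0.
Qed.

(** By local constancy, both the level set of [G p0] in [U] and its complement in [U] are open;
    connectedness makes the level set all of [U]. *)
Lemma zero_partials_cst (R : realType) (U : set (R * R)) (G : R * R -> R) :
  open U -> connected U ->
  (forall p, U p -> differentiable G p) ->
  (forall p, U p -> partialx G p = 0 /\ partialy G p = 0) ->
  exists C, forall p, U p -> G p = C.
Proof.
move=> oU cU dG G0.
have [[p0 Up0]|U0] := pselect (U !=set0); last first.
  by exists 0 => p Up; case: U0; exists p.
exists (G p0); pose B := U `&` [set p | G p = G p0].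
have loc p : U p -> \forall q \near p, U q /\ G q = G p.
  move=> Up; have /nbhs_ballP[e /= e0 eU] := open_nbhs_nbhs (conj oU Up).
  apply/nbhs_ballP; exists e => //= q pq; split; first exact: eU.
  by apply: zero_partials_locally_cst pq => r /eU; [exact: dG|exact: G0].
suff BU : B = U by move=> p; rewrite -BU => -[].
apply: cU; first by exists p0.
  exists B; last by rewrite /B setIA setIid.
  rewrite openE => p [Up Gp]; rewrite /interior /B.
  by apply: filterS (loc _ Up) => q [Uq Gq]; split; rewrite //= Gq.
(* A closed set that cuts out [B] on [U]: the complement of the open set of points of [U] where [G]
   differs from [G p0]. *)
exists (~` (U `&` [set p | G p != G p0])).
  apply/open_closedC; rewrite openE => p [Up Gp].
  by apply: filterS (loc _ Up) => q [Uq Gq]; split; rewrite //= Gq.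
apply/seteqP; split => p [Up Gp]; split => //=.
  by move=> -[_]; rewrite Gp eqxx.
by apply/eqP; apply: contrapT => /negP Gp'; exact: Gp.
Qed.

Theorem theorem3p1 (R : realType) (U : set (R * R))
    (oU : open U) (cU : connected U) (M N : R * R -> R)
    (smooth_M : smooth_on U M) (smooth_N : smooth_on U N)
    (closed_MN : forall p, U p -> partialx N p = partialy M p)
    (trivial_class : dR_class (ClosedForm oU smooth_M smooth_N closed_MN) = 0) :
  exists F : R * R -> R,
    [/\ primitive_on U (M, N) F,
        forall (I : set R) (x y : R -> R),
          is_interval I -> I° !=set0 ->
          C1_within I x -> C1_within I y ->
          (forall t, I t -> U (x t, y t)) ->
          ((forall t, I t ->
              M (x t, y t) * derive_within I x t
              + N (x t, y t) * derive_within I y t = 0) <->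
           (exists C : R, forall t, I t -> F (x t, y t) = C))
      & forall F' : R * R -> R, primitive_on U (M, N) F' ->
          exists C : R, forall p, U p -> F p - F' p = C].
Proof.
have [F [sF dF]] : exact_on U (M, N) by move/dR_class_eq0 : trivial_class.
have diffF G : smooth_on U G -> forall p, U p -> differentiable G p.
  by move=> sG p; exact: smooth_on_differentiable.
exists F; split => //.
- move=> I x y iI I0 [dx _] [dy _] xyU.
  have dFxy t (It : I t) := cvg_diff_quotient_comp (diffF _ sF _ (xyU t It))
    (dx t It) (dy t It).
  have {}dFxy t : I t ->
      diff_quotient (fun s => F (x s, y s)) t s @[s --> within I t^'] -->
      M (x t, y t) * derive_within I x t + N (x t, y t) * derive_within I y t.
    by move=> It; have := dFxy t It; have [-> ->] := dF _ (xyU t It).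
  split=> [w0|[C FC] t It].
    have [t0 It0] := I0; exists (F (x t0, y t0)) => t It.
    apply: (diff_quotient0_cst (g := fun s => F (x s, y s)) iI) => //.
      by move=> s Is; rewrite -(w0 s Is); exact: dFxy.
    exact: interior_subset.
  (* The quotient of the constant [F] along the curve tends to 0 as well as to the left side of the
     equation; by properness the two limits agree. *)
  have PI := within_dnbhs_proper iI I0 It.
  apply: (cvg_unique _ (dFxy t It)) => //.
  apply: cvg_near_cst; apply: filterS (near_within_dnbhs I t) => s [Is _].
  by rewrite /diff_quotient !FC// subrr mul0r.
- move=> F' [sF' dF'].
  apply: (@zero_partials_cst R U (F - F')) => // p Up.
    by apply: differentiableB; exact: diffF Up.
  have [Fx Fy] := dF p Up; have [F'x F'y] := dF' p Up.
  by rewrite partialxB ?partialyB ?Fx ?Fy ?F'x ?F'y ?subrr//; exact: diffF Up.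
Qed.
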